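(* Let $\mathcal{I}_a \subseteq \mathcal{I}$ and $i \in \mathcal{I}_a$. A perfectly undetectable attack conducted with components $\mathcal{I}_a$ in which component $i$ is actively used exists if and only if $$\operatorname{normrank} G^{(\mathcal{I}_a)} = \operatorname{normrank} G^{(\mathcal{I}_a\setminus \{i\})}.$$
   Context: System model. Consider the discrete-time linear system, $k\in\mathbb{Z}_{\ge 0}$, $$x(k+1)=Ax(k)+Bu(k)+B_a a(k),\qquad y(k)=Cx(k)+D_a a(k),$$ with state $x(k)\in\mathbb{R}^{n_x}$, control input $u(k)\in\mathbb{R}^{n_u}$, measurements $y(k)\in\mathbb{R}^{n_y+n_e}$, attack vector $a(k)\in\mathbb{R}^{n_u+n_y}$, and real matrices $A,B,C$ of compatible sizes. The first $n_y$ measurements are unprotected sensors; the last $n_e\ge 0$ are protected and cannot be manipulated. The first $n_u$ entries of $a$ are attacks on actuators, the last $n_y$ are attacks on the unprotected sensors, so $$B_a=\begin{bmatrix} B & \mathbf{0}_{n_x\times n_y}\end{bmatrix},\qquad D_a=\begin{bmatrix}\mathbf{0}_{n_y\times n_u} & \mathbf{I}_{n_y}\\ \mathbf{0}_{n_e\times n_u} & \mathbf{0}_{n_e\times n_y}\end{bmatrix}.$$ $B$ has full column rank. Throughout, $x(0)=0$ and $u=0$. $\mathcal{I}=\{1,\dots,n_u+n_y\}$ indexes the entries of $a$ (actuators and unprotected sensors, jointly called components), and $a^{(i)}$ is the $i$-th entry of the signal $a$. For a signal $s:\mathbb{Z}_{\ge 0}\to\mathbb{R}^{n}$, $s=0$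 means $s(k)=0$ for all $k$, and $s\neq 0$ means $s(k)\ne 0$ for at least one $k$. With $x(0)=0$, $u=0$, an attack signal $a\neq 0$ is perfectly undetectable if $y=0$. The attack is conducted with components $\mathcal{I}_a$ if $a^{(j)}=0$ for all $j\notin\mathcal{I}_a$; component $i$ is actively used if $a^{(i)}\neq 0$. $G(z)=C(zI-A)^{-1}B_a+D_a$ is the transfer function from $a$ to $y$; $G^{(\mathcal{I}_a)}$ is the matrix of the columns of $G$ with indices in $\mathcal{I}_a$; $\operatorname{normrank} G=\max\{\operatorname{rank}G(z): z\in\mathbb{C}\}$ (over $z$ at which $G(z)$ is defined; a matrix with no columns has normal rank $0$). *)

(* Defs.v *)
From mathcomp Require Import all_boot all_order all_algebra.
From mathcomp Require Import boolp classical_sets reals.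
From mathcomp.real_closed Require Import complex.

Set Implicit Arguments.
Unset Strict Implicit.
Unset Printing Implicit Defensive.

Import GRing.Theory.
Local Open Scope ring_scope.
Local Open Scope complex_scope.

Definition signal (R : realType) (n : nat) := nat -> 'cV[R]_n.

Definition signal_neq0 (R : realType) (n : nat) (s : signal R n) : Prop :=
  exists k, s k <> 0.

Definition signal_entry (R : realType) (n : nat) (s : signal R n) (i : 'I_n)
    (k : nat) : R := s k i 0.

Section System.
Variables (R : realType) (nx nu ny ne : nat).
Variables (A : 'M[R]_nx) (B : 'M[R]_(nx, nu)) (C : 'M[R]_(ny + ne, nx)).

Definition attack_Ba : 'M[R]_(nx, nu + ny) := row_mx B 0.

Definition attack_Da : 'M[R]_(ny + ne, nu + ny) := block_mx 0 1%:M 0 0.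

Fixpoint state (x0 : 'cV[R]_nx) (u : signal R nu) (a : signal R (nu + ny))
    (k : nat) : 'cV[R]_nx :=
  if k is k'.+1 then
    A *m state x0 u a k' + B *m u k' + attack_Ba *m a k'
  else x0.

Definition output (x0 : 'cV[R]_nx) (u : signal R nu) (a : signal R (nu + ny)) :
    signal R (ny + ne) :=
  fun k => C *m state x0 u a k + attack_Da *m a k.

Definition perfectly_undetectable (a : signal R (nu + ny)) : Prop :=
  signal_neq0 a /\ forall k, output 0 (fun=> 0) a k = 0.

Definition conducted_with (Ia : {set 'I_(nu + ny)}) (a : signal R (nu + ny)) :
    Prop :=
  forall j, j \notin Ia -> forall k, signal_entry a j k = 0.

Definition actively_used (i : 'I_(nu + ny)) (a : signal R (nu + ny)) : Prop :=
  exists k, signal_entry a i k <> 0.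

(* [invmx M] is [M] itself when [M] is singular, so [transfer z] is meaningful
   only for [z] in [transfer_dom]. *)
Definition transfer_dom : set R[i] :=
  [set z | z%:M - map_mx (real_complex R) A \in unitmx].

Definition transfer (z : R[i]) : 'M[R[i]]_(ny + ne, nu + ny) :=
  map_mx (real_complex R) C *m invmx (z%:M - map_mx (real_complex R) A)
    *m map_mx (real_complex R) attack_Ba
  + map_mx (real_complex R) attack_Da.

End System.

(* The columns are kept in increasing order of their index. *)
Definition select_cols (K : Type) (m n : nat) (I : {set 'I_n})
    (M : 'M[K]_(m, n)) : 'M[K]_(m, #|I|) :=
  colsub (fun j : 'I_#|I| => enum_val j) M.

(* The maximum of [\rank (M z)] over [z] in [D]; the ranks attained range over
   0, ..., n.  It is 0 if [D] is empty. *)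
Definition normrank (K : fieldType) (D : set K) (m n : nat)
    (M : K -> 'M[K]_(m, n)) : nat :=
  \max_(r < n.+1 | `[< exists2 z, D z & \rank (M z) = r >]) r.

(* Main.v *)
Require Import Defs.
From mathcomp Require Import all_boot all_order fingroup perm all_algebra.
From mathcomp Require Import boolp classical_sets reals.
From mathcomp.real_closed Require Import complex.

Set Implicit Arguments.
Unset Strict Implicit.
Unset Printing Implicit Defensive.

Import GRing.Theory.
Local Open Scope ring_scope.

(* Over [R[z]], put [Q = C adj(z - A) B_a + chi_A D_a], so [G = Q / chi_A]; the
   normal rank of a set of columns of [G] is the rank of those columns of [Q]
   over the field of rational functions, and the two normal ranks agree iff
   column [i] of [Q] is a rational combination of the other columns in [I_a].
   For a signal [s], let [s_N(z) = sum_(k < N) s(k) z^(N-1-k)].  The state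
   equation gives [Q a_N = chi_A y_N + C adj(z - A) x(N)], where the last term
   has degree bounded independently of [N].
   If column [i] is independent of the others, some polynomial row [c] satisfies
   [(c Q)_i <> 0] and [(c Q)_j = 0] for the other [j]; when [y = 0] this makes
   [(c Q)_i (a_i)_N] of bounded degree, hence [a_i = 0].
   If it is dependent, clearing denominators gives a polynomial vector [v] with
   [Q v = 0] and [v_i <> 0]; reading its coefficients backwards as an attack,
   [chi_A y_N = - C adj(z - A) x(N)] for large [N], and since [adj(z - A)] has
   smaller degree than [chi_A], [y = 0]. *)

(** * Clearing denominators in a fraction field *)

Lemma fraction_clear_denom (S : idomainType) (x : {fraction S}) :
  exists nd : S * S, nd.2 != 0 /\ tofrac nd.2 * x = tofrac nd.1.
Proof.
elim/quotW: x => x; exists (\n_x, \d_x); split; first exact: denom_ratioP.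
(* Both sides are classes of pairs, so the equality becomes cross-multiplication of
   representatives. *)
unlock tofrac; rewrite -[LHS]FracField.pi_mul; apply/eqmodP.
rewrite /= FracField.equivfE /FracField.mulf.
rewrite !numden_Ratio ?mulf_neq0 ?oner_neq0 ?denom_ratioP //.
by rewrite !mul1r mulr1.
Qed.

Lemma fraction_mx_clear_denom (S : idomainType) (m n : nat)
    (M : 'M[{fraction S}]_(m, n)) :
  exists2 d : S, d != 0 &
    exists W : 'M[S]_(m, n), tofrac d *: M = map_mx (@tofrac S) W.
Proof.
have [nd ndP] := fin_all_exists
  (fun p : 'I_m * 'I_n => fraction_clear_denom (M p.1 p.2)).
exists (\prod_p (nd p).2); first by apply/prodf_neq0 => p _; case: (ndP p).
exists (\matrix_(a, b) ((\prod_(p | p != (a, b)) (nd p).2) * (nd (a, b)).1)).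
apply/matrixP => a b; rewrite !mxE (bigD1 (a, b)) //= !rmorphM /=.
by case: (ndP (a, b)) => _ <-; rewrite mulrAC mulrC.
Qed.

(** * Rank over the fraction field versus rank after specialization *)

Lemma exists_full_rank_minor (F : fieldType) (m n : nat) (M : 'M[F]_(m, n)) :
  exists f g, \det (mxsub f g M : 'M_(\rank M)) != 0.
Proof.
(* Independent rows are picked first, then, through the transpose, independent columns among
   them. *)
pose f := maxrankfun M; pose N := (rowsub f M)^T.
have Nfull : row_full N.
  by rewrite /row_full mxrank_tr; exact: maxrowsub_free.
exists f, (fullrankfun Nfull).
have := fullrowsub_unit Nfull; rewrite unitmxE unitfE -det_tr.
by congr (\det _ != 0); apply/matrixP => a b; rewrite !mxE.
Qed.

Lemma minor_neq0_rank (F : fieldType) (m n r : nat) (M : 'M[F]_(m, n)) f g :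
  \det (mxsub f g M : 'M_r) != 0 -> (r <= \rank M)%N.
Proof.
rewrite -unitfE -unitmxE => /mxrank_unit {1}<-.
have -> : mxsub f g M = rowsub f (colsub g M).
  by apply/matrixP => a b; rewrite !mxE.
apply: leq_trans (mxrankS (rowsub_sub _ _)) _.
rewrite -mxrank_tr -[leqRHS]mxrank_tr.
have -> : (colsub g M)^T = rowsub g M^T by apply/matrixP => a b; rewrite !mxE.
exact: mxrankS (rowsub_sub _ _).
Qed.

Section GenericRank.
Variables (S : idomainType) (m n : nat) (M : 'M[S]_(m, n)).

Let r := \rank (map_mx (@tofrac S) M).

(** A nonzero minor of the specialized matrix is the image under [f] of a minor over [S], which is
    then nonzero as well. *)
Lemma mxrank_specialization_le (K : fieldType) (f : {rmorphism S -> K}) :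
  (\rank (map_mx f M) <= r)%N.
Proof.
have [g [h]] := exists_full_rank_minor (map_mx f M).
rewrite -map_mxsub det_map_mx => det0.
apply: (@minor_neq0_rank _ _ _ _ _ g h); rewrite -map_mxsub det_map_mx tofrac_eq0.
by apply: contraNneq det0 => ->; rewrite rmorph0.
Qed.

Lemma mxrank_specialization_generic :
  exists2 s : S, s != 0 &
    forall (K : fieldType) (f : {rmorphism S -> K}),
      f s != 0 -> \rank (map_mx f M) = r.
Proof.
have [g [h]] := exists_full_rank_minor (map_mx (@tofrac S) M).
rewrite -map_mxsub det_map_mx tofrac_eq0 => det0.
(* One maximal nonzero minor serves all specializations: where it survives, the rank cannot drop. *)
exists (\det (mxsub g h M : 'M_r)) => // K f fdet0.
apply/eqP; rewrite eqn_leq mxrank_specialization_le /=.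
by apply: (@minor_neq0_rank _ _ _ _ _ g h); rewrite -map_mxsub det_map_mx.
Qed.

End GenericRank.

Lemma normrank_eq (K : fieldType) (D : set K) (m n r : nat)
    (M : K -> 'M[K]_(m, n)) :
  (forall z, D z -> \rank (M z) <= r)%N ->
  (exists2 z, D z & \rank (M z) = r) -> normrank D M = r.
Proof.
move=> le_r [z Dz rankz]; apply/eqP; rewrite eqn_leq; apply/andP; split.
  by apply/bigmax_leqP => j /asboolP[w Dw <-]; exact: le_r.
have ltr : (r < n.+1)%N by rewrite ltnS -rankz rank_leq_col.
by apply: (@leq_bigmax_cond _ _ _ (Ordinal ltr)); apply/asboolP; exists z.
Qed.

(** * Selected columns: span, annihilators and rank *)

Section SelectCols.
Variables (n : nat) (I : {set 'I_n}).

Lemma map_select_cols (K L : Type) (f : K -> L) m (M : 'M[K]_(m, n)) :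
  map_mx f (select_cols I M) = select_cols I (map_mx f M).
Proof. exact: map_mxsub. Qed.

(** Coefficients are indexed by all columns and supported in [I], which matches the form of
    [conducted_with] and avoids the enumeration of [I]. *)
Lemma submx_select_colsP (F : fieldType) m (M : 'M[F]_(m, n)) (u : 'rV_m) :
  reflect (exists2 v : 'cV_n, (forall j, j \notin I -> v j 0 = 0) & M *m v = u^T)
          (u <= (select_cols I M)^T)%MS.
Proof.
have selE : select_cols I M = M *m select_cols I 1%:M.
  by rewrite /select_cols mulmx_colsub mulmx1.
apply: (iffP submxP) => [[D ->] | [v v0 Mv]].
  exists ((select_cols I 1%:M) *m D^T); last by rewrite mulmxA -selE trmx_mul trmxK.
  move=> j jI; rewrite mxE big1 // => k _; rewrite !mxE.
  by case: eqP jI => [->|_ _]; rewrite ?mul0r // enum_valP.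
exists (\row_k v (enum_val k) 0); apply: trmx_inj; rewrite -Mv trmx_mul trmxK.
apply/matrixP => a b; rewrite !mxE (ord1 b) (bigID (mem I)) /= [X in _ + X]big1 ?addr0.
  by rewrite big_enum_val; apply: eq_bigr => k _; rewrite !mxE.
by move=> j jI; rewrite v0 // mulr0.
Qed.

Lemma select_cols_kernelP (F : fieldType) m p (M : 'M[F]_(m, n)) (c : 'M_(p, m)) :
  c *m select_cols I M = 0 <-> (forall k j, j \in I -> (c *m M) k j = 0).
Proof.
rewrite /select_cols mulmx_colsub; split=> [cM0 k j jI | cM0].
  by have /matrixP/(_ k (enum_rank_in jI j)) := cM0; rewrite !mxE enum_rankK_in.
by apply/matrixP => k j; rewrite mxE cM0 ?mxE // enum_valP.
Qed.

End SelectCols.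

(** The smaller column span always lies in the larger one, so equal ranks force equal spans; only
    column [i] can make a difference. *)
Lemma mxrank_select_cols_setD1 (F : fieldType) m n (I : {set 'I_n}) i
    (M : 'M[F]_(m, n)) :
  i \in I ->
  \rank (select_cols I M) = \rank (select_cols (I :\ i) M) <->
  ((col i M)^T <= (select_cols (I :\ i) M)^T)%MS.
Proof.
move=> iI; rewrite -mxrank_tr -[RHS]mxrank_tr.
set V := (select_cols I M)^T; set W := (select_cols (I :\ i) M)^T.
have colV j : j \in I -> ((col j M)^T <= V)%MS.
  move=> jI; apply/submx_select_colsP; exists (delta_mx j 0); last first.
    by rewrite trmxK colE.
  by move=> k kI; rewrite mxE eqxx andbT; case: eqP kI => // ->; rewrite jI.
have colW j : j \in I -> j != i -> ((col j M)^T <= W)%MS.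
  move=> jI ji; apply/submx_select_colsP; exists (delta_mx j 0); last first.
    by rewrite trmxK colE.
  move=> k kI; rewrite mxE eqxx andbT; case: eqP kI => // ->.
  by rewrite !inE ji jI.
have rowE (J : {set 'I_n}) k :
    row k (select_cols J M)^T = (col (enum_val k) M)^T.
  by apply/matrixP => a b; rewrite !mxE.
have WV : (W <= V)%MS.
  apply/row_subP => k; rewrite rowE; apply: colV.
  by have := enum_valP k; rewrite in_setD1 => /andP[].
split=> [rkVW | iW].
  apply: submx_trans (colV i iI) _.
  by have [_] := mxrank_leqif_eq WV; rewrite rkVW eqxx => /esym/andP[].
apply/eqP; rewrite eqn_leq (mxrankS WV) andbT; apply: mxrankS.
apply/row_subP => k; rewrite rowE; have kI := enum_valP k.
by have [-> //|ki] := eqVneq (enum_val k) i; exact: colW.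
Qed.

(** Up to sign, an entry is a determinant of order [n - 1] with entries of degree at most 1, so its
    degree is below that of [char_poly A]. *)
Lemma size_adj_char_poly_mx (R : comNzRingType) n (A : 'M[R]_n) i j :
  (size (\adj (char_poly_mx A) i j) <= n)%N.
Proof.
case: n => [|n] in A i j *; first by case: i.
rewrite mxE /cofactor -signr_odd mulr_sign.
suff le_n (M : 'M[{poly R}]_n) :
    (forall a b, size (M a b) <= 2)%N -> (size (\det M) <= n.+1)%N.
  have /le_n : forall a b, (size (row' j (col' i (char_poly_mx A)) a b) <= 2)%N.
    move=> a b; rewrite !mxE; apply: leq_trans (size_polyD _ _) _.
    rewrite geq_max size_polyN (leq_trans (size_polyC_leq1 _)) // andbT.
    by case: eqP; rewrite ?mulr1n ?mulr0n ?size_polyX ?size_poly0.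
  by case: ifP; rewrite ?size_polyN.
move=> M2; apply: leq_trans (size_sum _ _ _) _; apply/bigmax_leqP => s _.
rewrite -signr_odd mulr_sign.
have le_n : (size (\prod_k M k (s k))%R <= n.+1)%N.
  apply: leq_trans (size_poly_prod_leq _ _) _; rewrite leq_subLR card_ord.
  rewrite addnS ltnS addnn -muln2 -[X in (X * _)%N]card_ord -sum_nat_const.
  exact: leq_sum.
by case: ifP; rewrite ?size_polyN.
Qed.

(** * Signals as polynomials, truncated and time-reversed *)

Section ReversedTruncation.
Variables (R : realType) (n : nat).
Implicit Types s : signal R n.

(* [revpoly s N] is [sum_(k < N) s(k) z^(N-1-k)]. *)
Fixpoint revpoly s (N : nat) : 'cV[{poly R}]_n :=
  if N is N'.+1 then 'X *: revpoly s N' + map_mx polyC (s N') else 0.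

Lemma revpolyS s N : revpoly s N.+1 = 'X *: revpoly s N + map_mx polyC (s N).
Proof. by []. Qed.

Lemma size_revpoly s N j : (size (revpoly s N j 0%R) <= N)%N.
Proof.
elim: N => [|N IHN] /=; rewrite !mxE ?size_poly0 //.
apply: leq_trans (size_polyD _ _) _; rewrite geq_max.
rewrite (leq_trans (size_polyC_leq1 _)) // andbT mulrC.
by have [->|nz] := eqVneq (revpoly s N j 0) 0; rewrite ?mul0r ?size_poly0 ?size_mulX.
Qed.

Lemma coef_revpoly s N k j : (k < N)%N ->
  (revpoly s N j 0)`_(N.-1 - k) = signal_entry s j k.
Proof.
elim: N => // N IHN; rewrite ltnS leq_eqVlt => /predU1P[-> | ltkN].
  by rewrite subnn /= !mxE coefD coefXM coefC eqxx add0r.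
rewrite /= !mxE coefD coefXM coefC -IHN //= subn_eq0 leqNgt ltkN addr0.
by rewrite -subn1 subnAC subn1.
Qed.

Lemma revpoly_eq0 s N : (forall k, s k = 0) -> revpoly s N = 0.
Proof. by move=> s0; elim: N => //= N ->; rewrite s0 map_mx0 scaler0 addr0. Qed.

Lemma revpoly_signal_entry_eq0 s j N :
  (forall k, signal_entry s j k = 0) -> revpoly s N j 0 = 0.
Proof.
move=> s0; elim: N => [|N IHN] /=; rewrite !mxE //.
by rewrite IHN mulr0 add0r [s N j 0]s0.
Qed.

Lemma size_revpoly_signal_entry_neq0 s j k N :
  (k < N)%N -> signal_entry s j k <> 0 -> (N - k <= size (revpoly s N j 0%R))%N.
Proof.
move=> ltkN /eqP; rewrite -(coef_revpoly s j ltkN) => nz.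
case: N ltkN nz => // N; rewrite ltnS /= => lekN nz.
rewrite subSn //; rewrite ltnNge; apply: contra nz => ?.
by rewrite nth_default.
Qed.

(** Highest degree comes first, the order in which [revpoly] reads a signal. *)
Definition coef_signal (v : 'cV[{poly R}]_n) (N : nat) : signal R n :=
  fun k => if (k < N)%N then \col_j (v j 0)`_(N.-1 - k) else 0.

(** At time [N] all coefficients of [v] have been read; each later step appends a zero, that is,
    multiplies by ['X]. *)
Lemma revpoly_coef_signal (v : 'cV[{poly R}]_n) N : (forall j, size (v j 0%R) <= N)%N ->
  forall M, revpoly (coef_signal v N) (N + M) = 'X^M *: v.
Proof.
move=> szv; elim=> [|M IHM].
  rewrite addn0 expr0 scale1r; apply/matrixP => j l; rewrite (ord1 l).
  apply/polyP => p; have [ltpN | leNp] := ltnP p N; last first.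
    by rewrite !nth_default // (leq_trans _ leNp) ?size_revpoly.
  have ltN : (N.-1 - p < N)%N by case: N ltpN {szv} => // N _; rewrite ltnS leq_subr.
  have le_pN : (p <= N.-1)%N by case: N ltpN {szv ltN}.
  have := coef_revpoly (coef_signal v N) j ltN.
  by rewrite /signal_entry /coef_signal ltN mxE subKn.
rewrite addnS /= IHM /coef_signal ltnNge leq_addr /= map_mx0 addr0.
by rewrite scalerA -exprS.
Qed.

End ReversedTruncation.

Lemma signal_eq0_revpoly (R : realType) n (s : signal R n) (N : nat) :
  (forall M, revpoly s (N + M) = 0) -> forall k, s k = 0.
Proof.
move=> s0 k; apply/matrixP => j l; rewrite (ord1 l) mxE.
have ltk : (k < N + k.+1)%N by rewrite addnS ltnS leq_addl.
by have := coef_revpoly s j ltk; rewrite s0 mxE coef0.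
Qed.

(** * The polynomial numerator of the transfer function *)

Section TransferNumerator.
Variables (R : realType) (nx nu ny ne : nat).
Variables (A : 'M[R]_nx) (B : 'M[R]_(nx, nu)) (C : 'M[R]_(ny + ne, nx)).

Notation Ba := (attack_Ba ny B).
Notation Da := (attack_Da R nu ny ne).

Definition transfer_num : 'M[{poly R}]_(ny + ne, nu + ny) :=
  map_mx polyC C *m \adj (char_poly_mx A) *m map_mx polyC Ba
  + char_poly A *: map_mx polyC Da.

Let x (a : signal R (nu + ny)) := state A B 0 (fun=> 0) a.
Let y (a : signal R (nu + ny)) := output A B C 0 (fun=> 0) a.

(** This is the state equation summed against powers of ['X]: the initial term vanishes since the
    state starts at 0, and the final state is left over. *)
Lemma char_poly_mx_revpoly_state a N :
  char_poly_mx A *m revpoly (x a) N =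
    map_mx polyC Ba *m revpoly a N - map_mx polyC (x a N).
Proof.
elim: N => [|N IHN]; first by rewrite /= !mulmx0 map_mx0 subr0.
have -> : x a N.+1 = A *m x a N + Ba *m a N by rewrite /x /= mulmx0 addr0.
rewrite !revpolyS mulmxDr -scalemxAr IHN map_mxD !map_mxM.
rewrite /char_poly_mx mulmxBl mul_scalar_mx mulmxDr -scalemxAr scalerBr.
by rewrite opprD addrA subrK addrACA subrr addr0.
Qed.

Lemma revpoly_output a N :
  revpoly (y a) N =
    map_mx polyC C *m revpoly (x a) N + map_mx polyC Da *m revpoly a N.
Proof.
elim: N => [|N IHN]; first by rewrite /= !mulmx0 addr0.
rewrite !revpolyS IHN /y /output map_mxD !map_mxM !mulmxDr -!scalemxAr scalerDr.
by rewrite addrACA.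
Qed.

(* The [z]-transform relation between input and output, cut off at time [N]:
   the final state is the error term, and its degree stays bounded. *)
Lemma transfer_num_revpoly a N :
  transfer_num *m revpoly a N =
    char_poly A *: revpoly (y a) N
    + map_mx polyC C *m \adj (char_poly_mx A) *m map_mx polyC (x a N).
Proof.
have BaE : map_mx polyC Ba *m revpoly a N =
    char_poly_mx A *m revpoly (x a) N + map_mx polyC (x a N).
  by rewrite char_poly_mx_revpoly_state subrK.
rewrite mulmxDl -mulmxA BaE mulmxDr revpoly_output scalerDr addrAC.
congr (_ + _); rewrite -scalemxAl; congr (_ + _).
by rewrite mulmxA -[_ *m _ *m char_poly_mx A]mulmxA mul_adj_mx mul_mx_scalar
           scalemxAl.
Qed.

(** Only truncations from [N] on are constrained, because those of a signal built from a kernel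
    vector lie in the kernel only once the whole vector has been read. *)
Lemma output_eq0_of_kernel a N :
  (forall M, transfer_num *m revpoly a (N + M) = 0) -> forall k, y a k = 0.
Proof.
move=> Qa0; apply: (@signal_eq0_revpoly _ _ _ N) => M.
apply/matrixP => j l; rewrite (ord1 l) [RHS]mxE; apply/eqP.
have /eqP := transfer_num_revpoly a (N + M).
rewrite Qa0 eq_sym addr_eq0 => /eqP/matrixP/(_ j 0); rewrite !mxE => yE.
apply: contraTT isT => nz.
have := size_monicM (char_poly_monic A) nz.
rewrite yE size_polyN size_char_poly addSn /= => szE.
(* The left side is the size of the product with the monic [char_poly A]; the adjugate term it
   equals has size at most [nx]. *)
suff : (nx + size (revpoly (y a) (N + M) j 0%R) <= nx)%N.
  by rewrite -{2}[nx]addn0 leq_add2l leqn0 size_poly_eq0 (negPf nz).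
rewrite -szE; apply: leq_trans (size_sum _ _ _) _; apply/bigmax_leqP => k _.
rewrite [X in _ * X]mxE mulrC mul_polyC (leq_trans (size_scale_leq _ _)) //.
rewrite mxE; apply: leq_trans (size_sum _ _ _) _; apply/bigmax_leqP => h _.
by rewrite [X in X * _]mxE mul_polyC (leq_trans (size_scale_leq _ _)) // size_adj_char_poly_mx.
Qed.

(** In [c *m transfer_num *m revpoly a N] only the [i]-th term survives, and for zero output it
    equals a final-state term of degree bounded independently of [N]. *)
Lemma transfer_num_isolated_entry (a : signal R (nu + ny)) (i : 'I_(nu + ny))
    (c : 'rV[{poly R}]_(ny + ne)) :
  (forall k, y a k = 0) ->
  (forall j, j != i ->
     (c *m transfer_num) 0 j = 0 \/ forall k, signal_entry a j k = 0) ->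
  actively_used i a ->
  (c *m transfer_num) 0 i = 0.
Proof.
move=> y0 cQ [k0 aik0]; apply/eqP; apply: contraTT isT => q0.
pose r := c *m (map_mx polyC C *m \adj (char_poly_mx A)).
pose K := (\max_k size (r 0%R k))%N.
(* As [a] has a nonzero [i]-th entry at time [k0], this [N] gives its truncation size at least
   [K + 1], beyond the bound [K] on the final-state term. *)
pose N := (k0 + K).+1.
have := erefl (c *m (transfer_num *m revpoly a N)).
rewrite {2}transfer_num_revpoly (revpoly_eq0 _ y0) scaler0 add0r !mulmxA.
rewrite -[c *m _ *m \adj _]mulmxA -/r => /matrixP/(_ 0 0).
rewrite mxE (bigD1 i) // big1 => [qE | j /andP[_ ji]]; last first.
  case: (cQ j ji) => [-> | aj0]; first by rewrite mul0r.
  by rewrite revpoly_signal_entry_eq0 ?mulr0.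
have ltk0 : (k0 < N)%N by rewrite /N ltnS leq_addr.
have := size_revpoly_signal_entry_neq0 ltk0 aik0.
rewrite /N subSn ?leq_addr // addKn => ltK.
set g := revpoly a _ i 0 in qE ltK.
have {}qE : (c *m transfer_num) 0 i * g = (r *m map_mx polyC (x a N)) 0 0.
  by rewrite -qE [RHS]addr0.
have g0 : g != 0 by rewrite -size_poly_gt0 (leq_trans _ ltK).
have : (size ((r *m map_mx polyC (x a N)) 0%R 0%R) <= K)%N.
  rewrite mxE; apply: leq_trans (size_sum _ _ _) _; apply/bigmax_leqP => k _.
  rewrite [X in _ * X]mxE mulrC mul_polyC (leq_trans (size_scale_leq _ _)) //.
  exact: (leq_bigmax k).
rewrite -qE size_mul // => /leq_ltn_trans/(_ ltK); apply: contraLR => _.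
by rewrite -leqNgt (polySpred q0) addSn leq_addl.
Qed.

End TransferNumerator.

(** * Normal rank as rank over the rational functions *)

Section GenericTransferRank.
Variables (R : realType) (nx nu ny ne : nat).
Variables (A : 'M[R]_nx) (B : 'M[R]_(nx, nu)) (C : 'M[R]_(ny + ne, nx)).

Let ev (z : complex R) : {rmorphism {poly R} -> complex R} :=
  horner_eval z \o map_poly (real_complex R).

Let evC z c : ev z c%:P = real_complex R c.
Proof. by rewrite /ev /= /horner_eval map_polyC hornerC. Qed.

Let map_mx_evC z m n (M : 'M[R]_(m, n)) :
  map_mx (ev z) (map_mx polyC M) = map_mx (real_complex R) M.
Proof. by apply/matrixP => i j; rewrite !mxE evC. Qed.

Let map_mx_ev_char_poly_mx z :
  map_mx (ev z) (char_poly_mx A) = z%:M - map_mx (real_complex R) A.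
Proof.
rewrite /char_poly_mx map_mxB map_mx_evC map_scalar_mx.
by rewrite /ev /= /horner_eval map_polyX hornerX.
Qed.

Lemma transfer_num_scale z : transfer_dom A z ->
  exists2 d, d != 0 & map_mx (ev z) (transfer_num A B C) = d *: transfer A B C z.
Proof.
rewrite /transfer_dom /= => zU; exists (\det (z%:M - map_mx (real_complex R) A)).
  by rewrite -unitfE -unitmxE.
rewrite /transfer_num map_mxD map_mxZ !map_mxM !map_mx_evC map_mx_adj.
rewrite map_mx_ev_char_poly_mx /char_poly -det_map_mx map_mx_ev_char_poly_mx.
rewrite /transfer /invmx zU scalerDr -scalemxAr -scalemxAl scalerA.
by rewrite divff ?scale1r // -unitfE -unitmxE.
Qed.

Lemma normrank_transfer (I : {set 'I_(nu + ny)}) :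
  normrank (transfer_dom A) (fun z => select_cols I (transfer A B C z)) =
  \rank (map_mx (@tofrac {poly R}) (select_cols I (transfer_num A B C))).
Proof.
have rankE z : transfer_dom A z ->
    \rank (select_cols I (transfer A B C z)) =
    \rank (map_mx (ev z) (select_cols I (transfer_num A B C))).
  move=> /transfer_num_scale[d d0 QE]; rewrite map_select_cols QE.
  rewrite -(mxrank_scale_nz _ d0); congr (\rank _).
  by apply/matrixP => j k; rewrite !mxE.
apply: normrank_eq => [z Dz|]; first by rewrite rankE // mxrank_specialization_le.
have [s s0 rank_s] := mxrank_specialization_generic
  (select_cols I (transfer_num A B C)).
(* A non-root of this product both lies in [transfer_dom A] and attains the generic rank. *)
pose p := map_poly (real_complex R) (s * char_poly A).
have p0 : p != 0.
  by rewrite map_poly_eq0 mulf_neq0 // monic_neq0 ?char_poly_monic.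
have [k] : exists k : nat, ~~ root p k%:R.
  apply/not_existsP => rootp.
  (* In characteristic 0 these are [size p] distinct points, one more than the degree of [p], so
     they are not all roots. *)
  pose rs : seq (complex R) := [seq k%:R | k <- iota 0 (size p)].
  have := max_poly_roots p0 (rs := rs); rewrite size_map size_iota ltnn.
  rewrite map_inj_uniq ?iota_uniq; last exact: Num.Theory.mulrIn (oner_neq0 _).
  move=> H; suff // : false by []; apply: H => //.
  by apply/allP => _ /mapP[k _ ->]; apply: contraT => /rootp.
rewrite rootE => evp; have : ev k%:R (s * char_poly A) != 0 by [].
rewrite rmorphM mulf_eq0 negb_or => /andP[evs evX].
have Dk : transfer_dom A k%:R.
  by rewrite /transfer_dom /= unitmxE unitfE -map_mx_ev_char_poly_mx det_map_mx.
by exists k%:R => //; rewrite rankE // rank_s.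
Qed.

End GenericTransferRank.

Theorem proposition1 (R : realType) (nx nu ny ne : nat)
  (A : 'M[R]_nx) (B : 'M[R]_(nx, nu)) (C : 'M[R]_(ny + ne, nx))
  (B_full_column_rank : \rank B = nu)
  (Ia : {set 'I_(nu + ny)}) (i : 'I_(nu + ny)) (iIa : i \in Ia) :
  (exists a : signal R (nu + ny),
     [/\ perfectly_undetectable A B C a,
         conducted_with Ia a
       & actively_used i a])
  <->
  normrank (transfer_dom A) (fun z => select_cols Ia (transfer A B C z)) =
  normrank (transfer_dom A)
    (fun z => select_cols (Ia :\ i)%SET (transfer A B C z)).
Proof.
rewrite !normrank_transfer !map_select_cols mxrank_select_cols_setD1 //.
set Q := transfer_num A B C; set M := map_mx _ Q.
set W := (select_cols _ M)^T.
split=> [[a [[_ y0] aIa ai]] | /submx_select_colsP[v v0 Mv]].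
  rewrite submxE; apply: contraT => /matrix0Pn[l [k]]; rewrite (ord1 l) => nz.
  (* This cokernel vector annihilates the columns in [Ia :\ i] but, by [nz], not column [i]. *)
  pose c0 := (col k (cokermx W))^T.
  have [d d0 [c cE]] := fraction_mx_clear_denom c0.
  have cQE j : tofrac ((c *m Q) 0 j) = tofrac d * (c0 *m M) 0 j.
    have : map_mx (@tofrac _) (c *m Q) 0 j = (tofrac d *: c0 *m M) 0 j.
      by rewrite map_mxM cE.
    by rewrite -scalemxAl mxE => ->; rewrite mxE.
  have c0i : (c0 *m M) 0 i != 0.
    move: nz; rewrite !mxE; congr (_ != 0); apply: eq_bigr => h _.
    by rewrite !mxE mulrC.
  have c0W : c0 *m select_cols (Ia :\ i) M = 0.
    apply: trmx_inj; rewrite trmx_mul trmxK -/W trmx0.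
    by rewrite colE mulmxA mulmx_coker mul0mx.
  have cQ0 : (c *m Q) 0 i = 0.
    apply: (transfer_num_isolated_entry y0 _ ai) => j ji.
    have [jIa | jIa] := boolP (j \in Ia); [left | right; exact: aIa].
    apply/eqP; rewrite -tofrac_eq0 cQE.
    by move/select_cols_kernelP: c0W => ->; rewrite ?mulr0 // in_setD1 ji.
  have := cQE i; rewrite cQ0 tofrac0 => /esym/eqP.
  by rewrite mulf_eq0 tofrac_eq0 (negPf d0) (negPf c0i).
have [d d0 [w wE]] := fraction_mx_clear_denom v.
(* Since [M *m v] is column [i] and [v] vanishes at [i], this is a kernel vector with [i]-th entry
   [- d]. *)
pose u := w - d *: delta_mx i 0.
have Qu : Q *m u = 0.
  apply/matrixP => j l; rewrite [RHS]mxE; apply/eqP; rewrite -tofrac_eq0; apply/eqP.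
  suff : map_mx (@tofrac _) (Q *m u) = 0 by move/matrixP/(_ j l); rewrite !mxE.
  rewrite map_mxM map_mxB map_mxZ map_delta_mx -wE mulmxBr -!scalemxAr -/M Mv.
  by rewrite trmxK colE subrr.
have uIa j : j \notin Ia -> u j 0 = 0.
  move=> jIa; have ji : j != i by apply: contraNneq jIa => ->.
  have : map_mx (@tofrac _) w j 0 = 0.
    by rewrite -wE mxE v0 ?mulr0 // in_setD1 (negPf jIa) andbF.
  rewrite !mxE (negPf ji) mulr0 subr0 => /eqP.
  by rewrite tofrac_eq0 => /eqP.
have ui : u i 0 != 0.
  have : map_mx (@tofrac _) w i 0 = 0.
    by rewrite -wE mxE v0 ?mulr0 // in_setD1 eqxx.
  rewrite !mxE !eqxx mulr1 => /eqP; rewrite tofrac_eq0 => /eqP ->.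
  by rewrite sub0r oppr_eq0.
pose N := (\max_j size (u j 0%R))%N.
have szu j : (size (u j 0%R) <= N)%N by exact: (leq_bigmax j).
have revu := revpoly_coef_signal szu.
pose a := coef_signal u N.
have used : actively_used i a.
  apply: contrapT => /forallNP unused; case/negP: ui; apply/eqP.
  have := revu 0%N; rewrite expr0 scale1r => <-.
  by apply: revpoly_signal_entry_eq0 => k; apply: contrapT; exact: unused.
exists a; split=> // [|j jIa k].
  split.
    case: used => k aik; exists k => ak; apply: aik.
    by rewrite /signal_entry ak mxE.
  apply: (@output_eq0_of_kernel _ _ _ _ _ _ _ _ _ N) => M'.
  by rewrite revu -scalemxAr Qu scaler0.
by rewrite /signal_entry /a /coef_signal; case: ifP; rewrite mxE // uIa // coef0.
Qed.
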